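(* Let $\mathfrak{B}$ be a bornology with a closed base on a topological space $X$, and let $X$ be a $\mathfrak{B}$-Lindelöf space. The following hold. (1) $X$ satisfies $S_1(\mathcal{O}_{\mathfrak{B}},\Gamma_{\mathfrak{B}})$ if and only if $X$ satisfies $S_{fin}(\mathcal{O}_{\mathfrak{B}},\Gamma_{\mathfrak{B}})$. (2) $X$ satisfies $S_1(\mathcal{O}_{\mathfrak{B}},\Gamma)$ if and only if $X$ satisfies $S_{fin}(\mathcal{O}_{\mathfrak{B}},\Gamma)$.
   Context: A bornology $\mathfrak{B}$ on $X$ is a family of subsets of $X$ that is closed under taking subsets and finite unions and covers $X$; by standing convention $X\notin\mathfrak{B}$. A base of $\mathfrak{B}$ is a subfamily $\mathfrak{B}_0\subseteq\mathfrak{B}$ such that every $B\in\mathfrak{B}$ is contained in some $B_0\in\mathfrak{B}_0$; it is closed if its members are closed subsets of $X$. $\mathcal{O}_{\mathfrak{B}}$ is the collection of all open $\mathfrak{B}$-covers of $X$: families $\mathcal{U}$ of open subsets of $X$ with $X\notin\mathcal{U}$ such that every $B\in\mathfrak{B}$ is contained in some $U\in\mathcal{U}$. $X$ is $\mathfrak{B}$-Lindelöf if every open $\mathfrak{B}$-cover of $X$ contains a countable subfamily that is a $\mathfrak{B}$-cover of $X$. $\Gamma_{\mathfrak{B}}$ is the collection of all $\gamma_{\mathfrak{B}}$-covers of $X$: infinite covers $\mathcal{U}=\{U_n:n\in\omega\}$ of $X$ by proper open subsets such that for each $B\in\mathfrak{B}$ there is $n_0\in\omega$ with $B\subseteq U_n$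 for all $n\ge n_0$. $\Gamma$ is the collection of all $\gamma$-covers of $X$: infinite open covers $\mathcal{U}$ such that for each $x\in X$ the set $\{U\in\mathcal{U}:x\notin U\}$ is finite. For collections $\mathcal{A},\mathcal{B}$ of families of subsets of $X$: $S_1(\mathcal{A},\mathcal{B})$ means that for each sequence $\{\mathcal{U}_n:n\in\omega\}$ of elements of $\mathcal{A}$ there are $V_n\in\mathcal{U}_n$ ($n\in\omega$) with $\{V_n:n\in\omega\}\in\mathcal{B}$. $S_{fin}(\mathcal{A},\mathcal{B})$ means that for each such sequence there are finite (possibly empty) $\mathcal{V}_n\subseteq\mathcal{U}_n$ with $\bigcup_{n\in\omega}\mathcal{V}_n\in\mathcal{B}$. *)

(* Defs.v *)
From HB Require Import structures.
From mathcomp Require Import all_boot all_order all_algebra.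
From mathcomp Require Import all_classical topology.

Set Implicit Arguments.
Unset Strict Implicit.
Unset Printing Implicit Defensive.

Local Open Scope classical_set_scope.

(* The convention that the whole space is never bounded is part of the
   definition. *)
Definition bornology (X : Type) (BB : set (set X)) : Prop :=
  [/\ forall A B, BB B -> A `<=` B -> BB A,
      forall A B, BB A -> BB B -> BB (A `|` B),
      \bigcup_(B in BB) B = setT &
      ~ BB setT].

Definition bornology_base (X : Type) (BB BB0 : set (set X)) : Prop :=
  BB0 `<=` BB /\ forall B, BB B -> exists2 B0, BB0 B0 & B `<=` B0.

Definition has_closed_base (X : topologicalType) (BB : set (set X)) : Prop :=
  exists2 BB0, bornology_base BB BB0 & forall B, BB0 B -> closed B.

Definition open_bcovers (X : topologicalType) (BB : set (set X)) :
    set (set (set X)) :=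
  [set UU | [/\ forall U, UU U -> open U,
                ~ UU setT &
                forall B, BB B -> exists2 U, UU U & B `<=` U]].

Definition bornology_lindelof (X : topologicalType) (BB : set (set X)) : Prop :=
  forall UU, open_bcovers BB UU ->
  exists VV, [/\ VV `<=` UU, countable VV & open_bcovers BB VV].

(* A cover is a set of sets, so the enumeration [U_] witnessing that it is a
   gamma_B-cover is existentially quantified and may have repetitions. *)
Definition gamma_bcovers (X : topologicalType) (BB : set (set X)) :
    set (set (set X)) :=
  [set UU | [/\ infinite_set UU,
                \bigcup_(U in UU) U = setT,
                forall U, UU U -> open U /\ U <> setT &
                exists2 U_ : nat -> set X, UU = range U_ &
                  forall B, BB B ->
                  exists n0, forall n, (n0 <= n)%N -> B `<=` U_ n]].

Definition gamma_covers (X : topologicalType) : set (set (set X)) :=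
  [set UU | [/\ infinite_set UU,
                \bigcup_(U in UU) U = setT,
                forall U, UU U -> open U &
                forall x : X, finite_set [set U | UU U /\ ~ U x]]].

Definition S1 (X : Type) (AA CC : set (set (set X))) : Prop :=
  forall UU : nat -> set (set X), (forall n, AA (UU n)) ->
  exists2 V : nat -> set X, forall n, UU n (V n) & CC (range V).

Definition Sfin (X : Type) (AA CC : set (set (set X))) : Prop :=
  forall UU : nat -> set (set X), (forall n, AA (UU n)) ->
  exists2 VV : nat -> set (set X),
    forall n, finite_set (VV n) /\ VV n `<=` UU n & CC (\bigcup_n VV n).

(* Main.v *)
Require Import Defs.
From HB Require Import structures.
From mathcomp Require Import all_boot all_order all_algebra.
From mathcomp Require Import all_classical topology.

(** Going from one set per cover to finitely many is immediate: take
    singletons.  Conversely, let [UU n] be open B-covers.  The open sets that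
    lie below a member of each of [UU 0], ..., [UU n] again form an open
    B-cover, so the finite selection principle can be applied to these
    refinements.  It returns an infinite union [G] of finite families [VV n].
    Since [G] is infinite, for each [k] some [g k] in [G] avoids [VV 0], ...,
    [VV k.-1]; it therefore belongs to a later [VV n], and so lies below some
    [V k] in [UU k].  A given member of [G] appears in some [VV n], hence it
    differs from [g k] for all [k > n].  So any test set contained in all but
    finitely many members of [G] is contained in [g k], and thus in [V k], for
    all large [k] ([diagonal_selection]).

    The sequence [V] may repeat members, but its range is still infinite: a set
    occurring infinitely often would have to contain every point, while the
    members of the [UU n] are proper ([infinite_range_eventually]).

    Both parts are instances of this argument, the test sets being the bounded
    sets for the first and the singletons for the second. *)

Set Implicit Arguments.
Unset Strict Implicit.
Unset Printing Implicit Defensive.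

Local Open Scope classical_set_scope.

Lemma S1_Sfin (X : Type) (AA CC : set (set (set X))) :
  S1 AA CC -> Sfin AA CC.
Proof.
move=> S1AC UU UUA; have [V VU VC] := S1AC UU UUA.
exists (fun n => [set V n]) => [n|].
  by split; [exact: finite_set1 | move=> _ ->].
suff -> : \bigcup_n [set V n] = range V by [].
by apply/seteqP; split => [_ [n _ ->]|_ [n _ <-]]; exists n.
Qed.

Lemma finite_nat_bounded (A : set nat) :
  finite_set A -> exists n0, forall k, A k -> (k < n0)%N.
Proof.
move=> /finite_seqP[s ->]; exists (\max_(i <- s) i).+1 => k /= ks.
by rewrite ltnS; exact: leq_bigmax_seq.
Qed.

Lemma finite_range_split (X : Type) (V : nat -> set X) (P : set X -> Prop) n0 :
  (forall n, (n0 <= n)%N -> P (V n)) ->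
  finite_set [set U | range V U /\ ~ P U].
Proof.
move=> VP; apply: (@sub_finite_set _ _ (V @` `I_n0)); last first.
  exact/finite_image/finite_II.
move=> _ [[n _ <-] nPV]; exists n => //=; rewrite ltnNge.
by apply/negP => /VP.
Qed.

(** A set taken infinitely often as a value would contain every point, so
    properness makes all fibres of [V] finite. *)
Lemma infinite_range_eventually (X : Type) (V : nat -> set X) :
  (forall n, V n <> setT) ->
  (forall x, exists n0, forall n, (n0 <= n)%N -> V n x) ->
  infinite_set (range V).
Proof.
move=> Vproper Vev finV; apply: infinite_nat.
apply: (@sub_finite_set _ _ (\bigcup_(U in range V) (V @^-1` [set U]))).
  by move=> n _; exists (V n) => //; exists n.
apply: bigcup_finite => // _ [m _ <-].
have [x nVx] : exists x, ~ V m x.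
  apply/existsNP => Vm; apply: (Vproper m).
  by apply/seteqP; split=> x _ //; exact: Vm.
have [n0 n0V] := Vev x.
apply: (@sub_finite_set _ _ `I_n0); last exact: finite_II.
move=> n /= VnE; rewrite ltnNge; apply/negP => /n0V.
by rewrite VnE.
Qed.

(** Keeping all open sets subordinate to the first [n.+1] covers, rather than
    only the intersections of their members, leaves the family a B-cover and
    avoids indexing by choices of members. *)
Definition refinement (X : topologicalType) (UU : nat -> set (set X))
    (n : nat) : set (set X) :=
  [set W | open W /\ forall i, (i <= n)%N -> exists2 U, UU i U & W `<=` U].

Lemma refinement_bcover (X : topologicalType) (BB : set (set X))
    (UU : nat -> set (set X)) n :
  (forall n, open_bcovers BB (UU n)) -> open_bcovers BB (refinement UU n).
Proof.
move=> UUB; split => [U []//|[_ /(_ 0%N isT)[U UU0 TU]]|B bB].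
  have [_ + _] := UUB 0%N; apply.
  suff <- : U = setT by [].
  by apply/seteqP; split.
elim: n => [|n [W [oW Wn] BW]].
  have [oU _ /(_ _ bB)[U UU0 BU]] := UUB 0%N.
  exists U => //; split; first exact: oU.
  by move=> i; rewrite leqn0 => /eqP ->; exists U.
have [oU _ /(_ _ bB)[U UUn BU]] := UUB n.+1.
exists (W `&` U); last by move=> x Bx; split; [exact: BW | exact: BU].
split; first by apply: openI => //; exact: oU.
move=> i; rewrite leq_eqVlt => /predU1P[->|/Wn[U' UUi WU']].
  by exists U => // x [].
by exists U' => // x [/WU'].
Qed.

Lemma infinite_bigcup_escape (T : Type) (VV : nat -> set T) k :
  (forall n, finite_set (VV n)) -> infinite_set (\bigcup_n VV n) ->
  exists2 g, (\bigcup_n VV n) g & forall i, (i < k)%N -> ~ VV i g.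
Proof.
move=> finVV infG; apply: contrapT => nex; apply: infG.
apply: (@sub_finite_set _ _ (\bigcup_(i in `I_k) VV i)); last first.
  by apply: bigcup_finite => //; exact: finite_II.
move=> g Gg; apply: contrapT => ng; apply: nex; exists g => // i ik VVg.
by apply: ng; exists i.
Qed.

(** Taking [g k] outside the first [k] finite families serves twice: it puts
    [g k] below a member of [UU k], and it makes the sequence [g] leave every
    finite subset of the union, in particular the finite set of members that
    do not contain a given test set. *)
Lemma diagonal_selection (X : topologicalType) (UU VV : nat -> set (set X))
    (FF : set (set X)) :
  (forall n, finite_set (VV n) /\ VV n `<=` refinement UU n) ->
  infinite_set (\bigcup_n VV n) ->
  (forall F, FF F ->
     finite_set [set U | (\bigcup_n VV n) U /\ ~ (F `<=` U)]) ->
  exists2 V : nat -> set X, forall n, UU n (V n) &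
    forall F, FF F -> exists n0, forall n, (n0 <= n)%N -> F `<=` V n.
Proof.
move=> VVP infG FFfin; set G := \bigcup_n VV n in infG FFfin.
have /choice[g gP] k : exists g, G g /\ forall i, (i < k)%N -> ~ VV i g.
  have [g] := @infinite_bigcup_escape _ VV k (fun n => (VVP n).1) infG.
  by exists g.
have /choice[V VP] k : exists V, UU k V /\ g k `<=` V.
  have [[n _ VVg] esc] := gP k.
  have [_ /(_ _ VVg)[_ below]] := VVP n.
  have [|U UUk gU] := below k; last by exists U.
  by rewrite leqNgt; apply/negP => /esc.
exists V => [n|F FFF]; first by have [] := VP n.
(* The indices [k] for which [g k] misses [F] form a finite union of
   fibres of [g], each bounded by an index where its value occurs. *)
have finbad : finite_set [set k | ~ (F `<=` g k)].
  apply: (@sub_finite_set _ _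
    (\bigcup_(U in [set U | G U /\ ~ (F `<=` U)]) (g @^-1` [set U]))).
    by move=> k nFg; exists (g k) => //; split=> //; have [] := gP k.
  apply: bigcup_finite => [|U [[m _ VVU] _]]; first exact: FFfin.
  apply: (@sub_finite_set _ _ `I_m.+1); last exact: finite_II.
  move=> k /= gkU; rewrite ltnNge; apply/negP => mk.
  by have [_ /(_ m mk)] := gP k; rewrite gkU.
have [n0 n0P] := finite_nat_bounded finbad.
exists n0 => n n0n; apply: (@subset_trans _ (g n)); last by have [] := VP n.
by apply: contrapT => /n0P; rewrite ltnNge n0n.
Qed.

(** The passage from finitely many sets per cover to one, common to the two
    parts: [CC] enters only through the infinity of its members and the
    finiteness condition that they satisfy with respect to the test sets. *)
Lemma Sfin_selection (X : topologicalType) (BB FF : set (set X))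
    (CC : set (set (set X))) :
  (forall GG, CC GG -> infinite_set GG) ->
  (forall GG F, CC GG -> FF F -> finite_set [set U | GG U /\ ~ (F `<=` U)]) ->
  Sfin (open_bcovers BB) CC ->
  forall UU : nat -> set (set X), (forall n, open_bcovers BB (UU n)) ->
  exists2 V : nat -> set X, forall n, UU n (V n) &
    forall F, FF F -> exists n0, forall n, (n0 <= n)%N -> F `<=` V n.
Proof.
move=> CCinf CCfin SBC UU UUB.
have [VV VVP VVC] := SBC _ (fun n => refinement_bcover n UUB).
apply: (diagonal_selection VVP) => [|F FFF]; first exact: CCinf.
exact: CCfin.
Qed.

Lemma open_bcovers_member (X : topologicalType) (BB UU : set (set X)) U :
  open_bcovers BB UU -> UU U -> open U /\ U <> setT.
Proof.
move=> [oU nT _] UUU; split; first exact: oU.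
by move=> UT; rewrite UT in UUU.
Qed.

Lemma bigcup_range_eventually (X : Type) (V : nat -> set X) :
  (forall x, exists n0, forall n, (n0 <= n)%N -> V n x) ->
  \bigcup_(U in range V) U = setT.
Proof.
move=> Vev; apply/seteqP; split => // x _.
by have [n0 /(_ n0 (leqnn _))] := Vev x; exists (V n0) => //; exists n0.
Qed.

Lemma Sfin_S1_gamma_bcovers (X : topologicalType) (BB : set (set X)) :
  bornology BB -> Sfin (open_bcovers BB) (gamma_bcovers BB) ->
  S1 (open_bcovers BB) (gamma_bcovers BB).
Proof.
move=> [_ _ BBT _] SBG UU UUB.
have [|GG F|V VU Vev] := Sfin_selection (FF := BB) _ _ SBG UUB.
- by move=> GG [].
- move=> [_ _ _ [U_ -> U_ev]] /U_ev[n0 n0P].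
  exact: (finite_range_split (P := fun U => F `<=` U) n0P).
exists V => //.
have Vpt x : exists n0, forall n, (n0 <= n)%N -> V n x.
  have [B bB Bx] : (\bigcup_(B in BB) B) x by rewrite BBT.
  by have [n0 n0P] := Vev _ bB; exists n0 => n /n0P; apply.
have Vmem n := open_bcovers_member (UUB n) (VU n).
split; [|exact: bigcup_range_eventually| |by exists V].
  by apply: infinite_range_eventually => // n; have [] := Vmem n.
by move=> _ [n _ <-].
Qed.

Lemma Sfin_S1_gamma_covers (X : topologicalType) (BB : set (set X)) :
  Sfin (open_bcovers BB) (@gamma_covers X) ->
  S1 (open_bcovers BB) (@gamma_covers X).
Proof.
move=> SBG UU UUB.
have [|GG F|V VU Vev] := Sfin_selection (FF := range set1) _ _ SBG UUB.
- by move=> GG [].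
- move=> [_ _ _ GGfin] [x _ <-]; apply: sub_finite_set (GGfin x).
  by move=> U [GGU nxU]; split=> // Ux; apply: nxU => _ ->.
exists V => //.
have Vpt x : exists n0, forall n, (n0 <= n)%N -> V n x.
  have [|n0 n0P] := Vev [set x]; first by exists x.
  by exists n0 => n /n0P; apply.
have Vmem n := open_bcovers_member (UUB n) (VU n).
split; [|exact: bigcup_range_eventually| |].
- by apply: infinite_range_eventually => // n; have [] := Vmem n.
- by move=> _ [n _ <-]; have [] := Vmem n.
- move=> x; have [n0 n0P] := Vpt x.
  exact: (finite_range_split (P := fun U => U x) n0P).
Qed.

Theorem theorem3p10 (X : topologicalType) (BB : set (set X))
  (bornBB : bornology BB) (baseBB : has_closed_base BB)
  (lindBB : bornology_lindelof BB) :
  (S1 (open_bcovers BB) (gamma_bcovers BB) <->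
   Sfin (open_bcovers BB) (gamma_bcovers BB)) /\
  (S1 (open_bcovers BB) (@gamma_covers X) <->
   Sfin (open_bcovers BB) (@gamma_covers X)).
Proof.
split; split; [exact: S1_Sfin | exact: Sfin_S1_gamma_bcovers |
  exact: S1_Sfin | exact: Sfin_S1_gamma_covers].
Qed.
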